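(* For integers $m>0$ and real numbers $k>0$ satisfying the equation $$1^k+2^k+\dots+(m-2)^k+(m-1)^k=m^k,$$ we have the asymptotic expansion $$k=\log 2\,\biggl(m-\frac32-\frac{c_1}{m}+O\Bigl(\frac1{m^2}\Bigr)\biggr)\quad\text{as } m\to\infty,$$ with $c_1=\frac{25}{12}-3\log 2\approx 0.00389\dots$. Moreover, if such a pair $(m,k)$ has $m>10^9$, then $$\frac km=\log 2\,\biggl(1-\frac{3}{2m}-\frac{C_m}{m^2}\biggr)\qquad\text{for some } C_m \text{ with } 0<C_m<0.004.$$
   Context: $\log$ denotes the natural logarithm. Here $k$ is a real (not necessarily integer) number; for each integer $m\ge 2$ the equation $\sum_{j=1}^{m-1}j^k=m^k$ has precisely one real solution $k$, so $k$ is viewed as a function of $m$, and the implied constant in $O(1/m^2)$ is absolute. *)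

(* Defs.v *)
From Stdlib Require Import Reals.
From Coquelicot Require Import Coquelicot.
Open Scope R_scope.

(* 1^k + ... + (m-1)^k = m^k.  All bases are positive, so [Rpower] is the
   genuine real power; the sum is empty (equal to 0) when m = 1. *)
Definition erdos_moser (m : nat) (k : R) : Prop :=
  sum_n_m (fun j : nat => Rpower (INR j) k) 1 (m - 1) = Rpower (INR m) k.

Definition coef1 : R := 25 / 12 - 3 * ln 2.

(* Main.v *)
(* With h = 1/m and j = m - i, the equation reads sum_(i<m) (1 - i h)^k = 1, whose
   left side decreases in k.  For k = ln 2 (m - 3/2 - c/m + e/m^2) one has
   (1 - i h)^k = 2^(-i) exp (ln 2 (u1 h + u2 h^2 + O(h^3))) with u1 = (3i - i^2)/2 and
   u2 = c i + 3i^2/4 - i^3/3.  Since sum_i i^p 2^(-i) = 1, 2, 6, 26, 150 for p = 0..4,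
   the order h term of the sum vanishes, and the order h^2 term
   ln 2 (2c - 25/6 + 6 ln 2) vanishes exactly for c = 25/12 - 3 ln 2.  At order h^3 the
   parameter e contributes -2 e ln 2, which beats the remainders, at most
   (46/5) i^6 h^3 2^(-i) per term, when |e| = 90000; so the root k has |e| < 90000
   once m > 10^9.  This keeps |C_m - c| = |e|/m below 10^(-4). *)
Require Import Defs.
From Stdlib Require Import Reals Lra Lia.
From Coquelicot Require Import Coquelicot.
Open Scope R_scope.

(** * Bounds for [ln] and [exp] with explicit remainders, each obtained from the sign of a
    derivative *)

Lemma derive_nonneg_incr (f f' : R -> R) (a b : R) :
  a <= b ->
  (forall x, a <= x <= b -> is_derive f x (f' x)) ->
  (forall x, a <= x <= b -> 0 <= f' x) ->
  f a <= f b.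
Proof.
  intros Hab Hf Hpos.
  destruct (MVT_gen f a b f') as [c [Hc Heq]].
  - intros x Hx; apply Hf; rewrite Rmin_left, Rmax_right in Hx by lra; lra.
  - intros x Hx; rewrite Rmin_left, Rmax_right in Hx by lra.
    apply continuity_pt_filterlim, (ex_derive_continuous f).
    exists (f' x); apply Hf; lra.
  - rewrite Rmin_left, Rmax_right in Hc by lra.
    specialize (Hpos c Hc); nra.
Qed.

Lemma ln2_bounds : 693147 / 1000000 <= ln 2 <= 6931474 / 10000000.
Proof.
  assert (H2 : ln 2 = ln (1 + 1 / 3) - ln (1 - 1 / 3)).
  { rewrite <- ln_div by lra; f_equal; field. }
  (* 2 artanh (1/3); the last term of the upper bound majorizes the tail, as 1/(1-x^2) <= 9/8. *)
  rewrite H2; split.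
  - pose proof (derive_nonneg_incr
      (fun x => ln (1 + x) - ln (1 - x)
         - 2 * (x + x^3/3 + x^5/5 + x^7/7 + x^9/9 + x^11/11))
      (fun x => 2 * x^12 / (1 - x^2)) 0 (1/3) ltac:(lra)) as H.
    cbv beta in H. rewrite Rplus_0_r, Rminus_0_r, ln_1 in H.
    enough (Hle : 0 - 0 - 2 * (0 + 0^3/3 + 0^5/5 + 0^7/7 + 0^9/9 + 0^11/11)
      <= ln (1 + 1/3) - ln (1 - 1/3) - 2 * (1/3 + (1/3)^3/3 + (1/3)^5/5 + (1/3)^7/7
         + (1/3)^9/9 + (1/3)^11/11)) by lra.
    apply H; intros x Hx.
    + auto_derive; [lra|]. field; nra.
    + apply Rdiv_le_0_compat; [|nra]. pose proof (pow_le x 12 (proj1 Hx)); lra.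
  - pose proof (derive_nonneg_incr
      (fun x => 2 * (x + x^3/3 + x^5/5 + x^7/7 + x^9/9 + x^11/11 + 9/8 * (x^13/13))
         - (ln (1 + x) - ln (1 - x)))
      (fun x => 2 * x^12 * (9/8 - / (1 - x^2))) 0 (1/3) ltac:(lra)) as H.
    cbv beta in H. rewrite Rplus_0_r, Rminus_0_r, ln_1 in H.
    enough (Hle : 2 * (0 + 0^3/3 + 0^5/5 + 0^7/7 + 0^9/9 + 0^11/11 + 9/8 * (0^13/13)) - (0 - 0)
      <= 2 * (1/3 + (1/3)^3/3 + (1/3)^5/5 + (1/3)^7/7
         + (1/3)^9/9 + (1/3)^11/11 + 9/8 * ((1/3)^13/13)) - (ln (1 + 1/3) - ln (1 - 1/3))) by lra.
    apply H; intros x Hx.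
    + auto_derive; [lra|]. field; nra.
    + apply Rmult_le_pos; [pose proof (pow_le x 12 (proj1 Hx)); lra|].
      assert (/ (1 - x^2) <= / (8/9)) by (apply Rinv_le_contravar; nra). lra.
Qed.

(** Each Taylor remainder of [exp] is the derivative of the next, so signs propagate upwards from
    [1 + x <= exp x]. The hypothesis is one-sided because the lemma is later applied to [v] that can
    be hugely negative. *)
Lemma exp_taylor2 (v : R) : v <= 1 ->
  Rabs (exp v - (1 + v + v^2/2)) <= Rabs v ^ 3.
Proof.
  assert (Hincr : forall a b, a <= b ->
      exp a - 1 - a - a^2/2 <= exp b - 1 - b - b^2/2).
  { intros a b Hab.
    apply (derive_nonneg_incr (fun x => exp x - 1 - x - x^2/2)
             (fun x => exp x - 1 - x)); [lra| |].
    - intros x _; auto_derive; [easy|field].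
    - intros x _; pose proof (exp_ineq1_le x); lra. }
  assert (Hlow : forall x, 1 + x + x^2/2 + x^3/6 <= exp x).
  { intros x; destruct (Rle_dec 0 x) as [Hx|Hx].
    - pose proof (derive_nonneg_incr (fun x => exp x - 1 - x - x^2/2 - x^3/6)
        (fun x => exp x - 1 - x - x^2/2) 0 x Hx) as H.
      cbv beta in H; rewrite exp_0 in H.
      enough (1 - 1 - 0 - 0^2/2 - 0^3/6 <= exp x - 1 - x - x^2/2 - x^3/6) by lra.
      apply H; intros y Hy.
      + auto_derive; [easy|field].
      + specialize (Hincr 0 y (proj1 Hy)); rewrite exp_0 in Hincr; lra.
    - pose proof (derive_nonneg_incr (fun x => - (exp x - 1 - x - x^2/2 - x^3/6))
        (fun x => - (exp x - 1 - x - x^2/2)) x 0 ltac:(lra)) as H.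
      cbv beta in H; rewrite exp_0 in H.
      enough (- (exp x - 1 - x - x^2/2 - x^3/6) <= - (1 - 1 - 0 - 0^2/2 - 0^3/6)) by lra.
      apply H; intros y Hy.
      + auto_derive; [easy|field].
      + specialize (Hincr y 0 (proj2 Hy)); rewrite exp_0 in Hincr; lra. }
  intros Hv; destruct (Rle_dec 0 v) as [H0|H0].
  - rewrite (Rabs_right v) by lra.
    (* The lower bound at [- v] becomes an upper bound for [exp v] through
       [exp v * exp (- v) = 1]. *)
    pose proof (Hlow v) as Hl. pose proof (Hlow (- v)) as Hm.
    pose proof (pow_le v 3 H0) as H3.
    rewrite Rabs_right by lra.
    assert (Hinv : exp v * exp (- v) = 1) by (rewrite <- exp_plus, Rplus_opp_r; apply exp_0).
    pose proof (exp_pos v) as Hp.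
    assert (Hd : 0 < 1 - v + v^2/2 - v^3/6) by nra.
    assert (Hprod : 1 <= (1 + v + v^2/2 + v^3) * (1 - v + v^2/2 - v^3/6)).
    (* The product minus 1 has no terms below degree 3, and the remaining cofactor is positive on
       [0, 1]. *)
    { enough (0 <= v^3 * (5/6 - 11/12 * v + 5/12 * v^2 - v^3/6)) by nra.
      apply Rmult_le_pos; nra. }
    assert (exp v * (1 - v + v^2/2 - v^3/6) <= 1) by nra.
    assert (exp v <= 1 + v + v^2/2 + v^3); [|lra].
    apply Rmult_le_reg_r with (2 := Rle_trans _ _ _ H Hprod); lra.
  - rewrite (Rabs_left v) by lra.
    specialize (Hlow v). specialize (Hincr v 0 ltac:(lra)). rewrite exp_0 in Hincr.
    assert (0 <= (-v)^3) by (apply pow_le; lra).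
    rewrite Rabs_left1 by lra. lra.
Qed.

Lemma ln_1_minus_le (y : R) : 0 <= y < 1 -> ln (1 - y) <= - (y + y^2/2 + y^3/3).
Proof.
  intros Hy.
  pose proof (derive_nonneg_incr (fun x => - (x + x^2/2 + x^3/3) - ln (1 - x))
    (fun x => x^3 / (1 - x)) 0 y (proj1 Hy)) as H.
  cbv beta in H; rewrite Rminus_0_r, ln_1 in H.
  enough (- (0 + 0^2/2 + 0^3/3) - 0 <= - (y + y^2/2 + y^3/3) - ln (1 - y)) by lra.
  apply H; intros x Hx.
  - auto_derive; [lra|field; lra].
  - apply Rdiv_le_0_compat; [apply pow_le|]; lra.
Qed.

(** The true derivative [x^3/(1 - x)] of the remainder is at most [2 x^3] up to 1/2, and integrating
    gives the term [y^4/2]. *)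
Lemma ln_1_minus_ge (y : R) : 0 <= y <= 1/2 ->
  - (y + y^2/2 + y^3/3 + y^4/2) <= ln (1 - y).
Proof.
  intros Hy.
  pose proof (derive_nonneg_incr (fun x => ln (1 - x) + (x + x^2/2 + x^3/3 + x^4/2))
    (fun x => x^3 * (2 - / (1 - x))) 0 y (proj1 Hy)) as H.
  cbv beta in H; rewrite Rminus_0_r, ln_1 in H.
  enough (0 + (0 + 0^2/2 + 0^3/3 + 0^4/2) <= ln (1 - y) + (y + y^2/2 + y^3/3 + y^4/2)) by lra.
  apply H; intros x Hx.
  - auto_derive; [lra|field; lra].
  - apply Rmult_le_pos; [apply pow_le; lra|].
    assert (/ (1 - x) <= / (1/2)) by (apply Rinv_le_contravar; lra). lra.
Qed.

(** * Finite sums, and polynomials weighted by powers of 1/2 *)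

Lemma sum_n_m_1_le (f g : nat -> R) (n : nat) :
  (forall i, (1 <= i <= n)%nat -> f i <= g i) -> sum_n_m f 1 n <= sum_n_m g 1 n.
Proof.
  induction n as [|n IH]; intros H.
  - rewrite !sum_n_m_zero by lia; apply Rle_refl.
  - rewrite !sum_n_Sm by lia.
    apply Rplus_le_compat; [apply IH; intros i Hi|]; apply H; lia.
Qed.

Lemma sum_n_m_1_rev (f : nat -> R) (n : nat) :
  sum_n_m f 1 n = sum_n_m (fun i => f (S n - i)%nat) 1 n.
Proof.
  induction n as [|n IH].
  - rewrite !sum_n_m_zero by lia; reflexivity.
  - rewrite (sum_Sn_m (fun i => f (S (S n) - i)%nat)) by lia.
    rewrite <- (sum_n_m_S (fun i => f (S (S n) - i)%nat)).
    rewrite sum_n_Sm by lia. rewrite IH, plus_comm. reflexivity.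
Qed.

(* The bracket after [(1/2)^n] is [sum_(t >= 1) P (n + t) / 2^t]. *)
Lemma sum_half_poly (a0 a1 a2 a3 a4 a6 a7 : R) (n : nat) :
  sum_n_m (fun i => (1/2)^i * (a0 + a1 * INR i + a2 * INR i^2 + a3 * INR i^3
                        + a4 * INR i^4 + a6 * INR i^6 + a7 * INR i^7)) 1 n
  = a0 + 2 * a1 + 6 * a2 + 26 * a3 + 150 * a4 + 9366 * a6 + 94586 * a7
    - (1/2)^n * (a0 + a1 * (INR n + 2) + a2 * (INR n^2 + 4 * INR n + 6)
        + a3 * (INR n^3 + 6 * INR n^2 + 18 * INR n + 26)
        + a4 * (INR n^4 + 8 * INR n^3 + 36 * INR n^2 + 104 * INR n + 150)
        + a6 * (INR n^6 + 12 * INR n^5 + 90 * INR n^4 + 520 * INR n^3 + 2250 * INR n^2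
                + 6492 * INR n + 9366)
        + a7 * (INR n^7 + 14 * INR n^6 + 126 * INR n^5 + 910 * INR n^4 + 5250 * INR n^3
                + 22722 * INR n^2 + 65562 * INR n + 94586)).
Proof.
  induction n as [|n IH].
  - rewrite sum_n_m_zero by lia. simpl; unfold zero; simpl; ring.
  - rewrite sum_n_Sm by lia. rewrite IH, S_INR. unfold plus; simpl; field.
Qed.

(** The partial sum of [i^7 / 2^i] is nonnegative, so its subtracted tail, which is at least
    [n^7 / 2^n], cannot exceed the full series 94586. *)
Lemma pow7_half_le (n : nat) : INR n ^ 7 * (1/2)^n <= 94586.
Proof.
  pose proof (sum_half_poly 0 0 0 0 0 0 1 n) as H.
  assert (Hp : 0 < (1/2)^n) by (apply pow_lt; lra).
  assert (Hj : forall j, 0 <= INR n ^ j) by (intros j; apply pow_le, pos_INR).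
  pose proof (Hj 6%nat). pose proof (Hj 5%nat). pose proof (Hj 4%nat).
  pose proof (Hj 3%nat). pose proof (Hj 2%nat). pose proof (pos_INR n).
  match type of H with ?s = _ => assert (Hs : 0 <= s) end.
  { apply Rle_trans with (sum_n_m (fun _ => 0) 1 n).
    - rewrite sum_n_m_const; lra.
    - apply sum_n_m_1_le; intros i _. apply Rmult_le_pos; [apply pow_le; lra|].
      pose proof (pow_le (INR i) 7 (pos_INR i)); lra. }
  rewrite H in Hs.
  apply Rle_trans with ((1/2)^n * (INR n^7 + 14 * INR n^6 + 126 * INR n^5 + 910 * INR n^4
    + 5250 * INR n^3 + 22722 * INR n^2 + 65562 * INR n + 94586)); [|lra].
  rewrite Rmult_comm. apply Rmult_le_compat_l; lra.
Qed.

(** * The constant [coef1] and the expansion of a single term *)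

Lemma coef1_bounds : 389 / 100000 <= coef1 < 390 / 100000.
Proof. unfold coef1; pose proof ln2_bounds; lra. Qed.

(* Second-order expansion in [h] of [2^a * (1 - a h)^k]. *)
Definition approx (h a : R) : R :=
  1 + ln 2 * ((3 * a - a^2) / 2 * h + (coef1 * a + 3/4 * a^2 - a^3/3) * h^2)
    + (ln 2 * ((3 * a - a^2) / 2) * h)^2 / 2.

(** All errors are measured in powers of [a^2 h], which dominates [r] because [a h <= 1]. The Taylor
    remainder costs [6.86 a^6 h^3], and dropping [r] from the quadratic term costs [1.6 a^6 h^3];
    together they stay below 17/2. The one-sided bound on [r] serves only to give [v <= 1]. *)
Lemma exp_perturb (a h r : R) :
  1 <= a -> 0 < h <= 1/10 -> a * h <= 1 ->
  Rabs r <= 17/10 * a^3 * h^2 -> r <= 4 * h^2 ->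
  Rabs (exp (ln 2 * ((3 * a - a^2) / 2 * h + r))
        - (1 + ln 2 * ((3 * a - a^2) / 2 * h + r)
           + (ln 2 * ((3 * a - a^2) / 2) * h)^2 / 2)) <= 17/2 * a^6 * h^3.
Proof.
  intros Ha Hh Hy Hr Hr4. pose proof ln2_bounds as HL.
  set (L := ln 2) in *. set (u := (3 * a - a^2) / 2).
  assert (Hu : Rabs (u * h) <= a^2 * h).
  { rewrite Rabs_mult, (Rabs_right h) by lra.
    apply Rmult_le_compat_r; [lra|]. apply Rabs_le; unfold u; nra. }
  assert (Ha2h : 0 <= a^2 * h) by (apply Rmult_le_pos; [apply pow_le|]; lra).
  assert (Hr' : Rabs r <= 17/10 * (a^2 * h)).
  { apply Rle_trans with (1 := Hr).
    replace (17/10 * a^3 * h^2) with (17/10 * (a^2 * h) * (a * h)) by ring. nra. }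
  set (v := L * (u * h + r)).
  assert (Hv1 : v <= 1).
  (* 9/8 is the maximum of [(3a - a^2)/2], attained at [a = 3/2]. *)
  { assert (u * h <= 9/8 * h) by (apply Rmult_le_compat_r; [lra|unfold u; pose proof (pow2_ge_0 (a - 3/2)); nra]).
    assert (h^2 <= 1/10 * h) by nra.
    unfold v. assert (u * h + r <= 1) by lra. nra. }
  assert (Hv : Rabs v <= 19/10 * (a^2 * h)).
  { unfold v. rewrite Rabs_mult, (Rabs_right L) by lra.
    pose proof (Rabs_triang (u * h) r). pose proof (Rabs_pos (u * h + r)). nra. }
  assert (Hv3 : Rabs v ^ 3 <= 686/100 * a^6 * h^3).
  { apply Rle_trans with ((19/10 * (a^2 * h))^3).
    - apply pow_incr; split; [apply Rabs_pos|easy].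
    - assert (0 <= (a^2*h)^3) by now apply pow_le.
      replace (686/100 * a^6 * h^3) with (686/100 * (a^2*h)^3) by ring.
      replace ((19/10 * (a^2 * h))^3) with (6859/1000 * (a^2*h)^3) by field. lra. }
  assert (Hq : Rabs (v^2/2 - (L * u * h)^2/2) <= 16/10 * a^6 * h^3).
  { replace (v^2/2 - (L * u * h)^2/2) with (L^2 * (r * (u * h + r/2)))
      by (unfold v; field).
    rewrite Rabs_mult, Rabs_mult, (Rabs_right (L^2)) by nra.
    assert (H2 : Rabs (u * h + r / 2) <= 185/100 * (a^2 * h)).
    { pose proof (Rabs_triang (u * h) (r/2)).
      assert (Rabs (r / 2) = Rabs r / 2)
        by (unfold Rdiv; rewrite Rabs_mult, (Rabs_right (/2)); lra). lra. }
    pose proof (Rmult_le_compat _ _ _ _ (Rabs_pos _) (Rabs_pos _) Hr H2) as H3.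
    assert (H5 : 17/10 * a^3 * h^2 * (185/100 * (a^2*h)) <= 3145/1000 * (a^6 * h^3)).
    { replace (17/10 * a^3 * h^2 * (185/100 * (a^2*h))) with
        (3145/1000 * (a^5 * h^3)) by field.
      assert (0 <= a^5 * h^3) by (apply Rmult_le_pos; apply pow_le; lra).
      replace (a^6 * h^3) with (a * (a^5 * h^3)) by ring. nra. }
    assert (HL2 : L^2 <= 49/100) by nra.
    pose proof (Rmult_le_compat (L^2) (49/100) _ _ ltac:(nra)
      (Rmult_le_pos _ _ (Rabs_pos r) (Rabs_pos (u*h+r/2))) HL2 (Rle_trans _ _ _ H3 H5)).
    assert (0 <= a^6 * h^3) by (apply Rmult_le_pos; apply pow_le; lra). lra. }
  pose proof (exp_taylor2 v Hv1) as Ht.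
  replace (exp v - _) with
    ((exp v - (1 + v + v^2/2)) + (v^2/2 - (L * u * h)^2/2)) by (unfold v; field).
  eapply Rle_trans; [apply Rabs_triang|].
  assert (0 <= a^6 * h^3) by (apply Rmult_le_pos; apply pow_le; lra). lra.
Qed.

Lemma cubic_le_4 (a : R) : 1 <= a -> a + 3/4 * a^2 - a^3/4 <= 4.
Proof.
  (* The cubic with a double root at 13/5, near the maximizer of the left side, certifies the
     bound. *)
  intros Ha.
  pose proof (Rmult_le_pos _ (a + 22/10) (pow2_ge_0 (a - 26/10)) ltac:(lra)). lra.
Qed.

(* [ln 2 * (m - 3/2 - coef1/m + e/m^2)] with [h = 1/m]. *)
Definition exponent (e h : R) : R :=
  ln 2 / h * (1 - 3/2 * h - coef1 * h^2 + e * h^3).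

Lemma exponent_factor_bounds (e h : R) :
  -90000 <= e <= 90000 -> 0 < h <= / 10^9 ->
  1/2 <= 1 - 3/2 * h - coef1 * h^2 + e * h^3 <= 1.
Proof.
  intros He Hh. pose proof coef1_bounds.
  assert (0 < h^2 <= 1/1000000000 * h) by nra.
  assert (0 < h^3 <= 1/1000000000 * h^2) by nra.
  split; nra.
Qed.

Lemma exponent_pos (e h : R) :
  -90000 <= e <= 90000 -> 0 < h <= / 10^9 -> 0 < exponent e h.
Proof.
  intros He Hh. pose proof (exponent_factor_bounds e h He Hh). pose proof ln2_bounds.
  apply Rmult_lt_0_compat; [apply Rdiv_lt_0_compat|]; lra.
Qed.

(** As the exponent is positive, the upper bound for [ln] applies. Here [r] collects what follows
    the order [h] term. The constant 46/5 is 17/2 from [exp_perturb] plus 7/10, which bounds the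
    factor [ln 2] of [a^3 h^3] in [r]. *)
Lemma term_le (a h : R) :
  1 <= a -> 0 < h <= / 10^9 -> a * h < 1 ->
  exp (exponent 90000 h * ln (1 - a * h))
  <= exp (- (ln 2 * a)) * (approx h a + (46/5 * a^6 - ln 2 * 90000 * a) * h^3).
Proof.
  intros Ha Hh Hy. pose proof ln2_bounds as HL. pose proof coef1_bounds as Hc.
  pose proof (exponent_pos 90000 h ltac:(lra) Hh) as Hk.
  set (r := (coef1 * a + 3/4 * a^2 - a^3/3) * h^2 + (a^3 - 90000 * a) * h^3).
  assert (Hh' : 0 < h <= 1/1000000000) by lra.
  assert (Hay : 0 < a * h) by nra.
  assert (Ha23 : 1 <= a /\ a <= a^2 /\ a^2 <= a^3) by (repeat split; nra).
  assert (Hh2 : 0 < h^2) by nra.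
  assert (Hah : a * h^3 <= 1/1000000000 * (a * h^2)) by (assert (0 < a * h^2) by nra; nra).
  assert (H3h : 0 < a^3 * h^3 <= 1/1000000000 * (a^3 * h^2)).
  { assert (0 < a^3 * h^2) by nra. split; nra. }
  assert (Hexp : exponent 90000 h * ln (1 - a * h)
     <= - (ln 2 * a) + ln 2 * ((3 * a - a^2) / 2 * h + r)).
  { apply Rle_trans with
      (exponent 90000 h * (- (a * h + (a * h)^2/2 + (a * h)^3/3))).
    - apply Rmult_le_compat_l; [lra|]. apply ln_1_minus_le; lra.
    (* The exact [h^3] coefficient has only [a^3/2 + coef1 a^2/2] in place of the [a^3] in [r]; the
       spare [a^3/2] absorbs the [coef1] terms. *)
    - apply Rminus_le_0. unfold exponent, r.
      replace (_ - _) with (ln 2 * h^3 * (a^3/2 - coef1 * a^2/2 - coef1 * a^2 * (a*h)/3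
         + 90000 * a * (a*h/2 + (a*h)^2/3))) by (field; lra).
      apply Rmult_le_pos; [nra|].
      assert (0 <= 90000 * a * (a*h/2 + (a*h)^2/3)) by (apply Rmult_le_pos; nra).
      assert (coef1 * a^2 <= 1/100 * a^2) by nra.
      assert (coef1 * a^2 * (a*h) <= 1/100 * a^2).
      { apply Rle_trans with (2 := H0). assert (0 <= coef1 * a^2) by nra. nra. }
      lra. }
  assert (Hr : Rabs r <= 17/10 * a^3 * h^2).
  { unfold r. apply Rabs_le; split; nra. }
  assert (Hr4 : r <= 4 * h^2).
  { assert (coef1 * a + 3/4 * a^2 - a^3/3 + (a^3 - 90000 * a) * h <= 4).
    { assert ((a^3 - 90000 * a) * h <= 1/100 * a^3) by nra.
      assert (coef1 * a <= 1/100 * a) by nra.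
      pose proof (cubic_le_4 a Ha). lra. }
    unfold r.
    replace (_ + _) with ((coef1 * a + 3/4 * a^2 - a^3/3 + (a^3 - 90000 * a) * h) * h^2) by ring.
    apply Rmult_le_compat_r; lra. }
  pose proof (exp_perturb a h r Ha ltac:(lra) ltac:(lra) Hr Hr4) as Hp.
  apply Rabs_le_between in Hp.
  apply Rle_trans with (exp (- (ln 2 * a) + ln 2 * ((3 * a - a^2) / 2 * h + r))).
  { destruct Hexp as [Hexp|Hexp]; [left; now apply exp_increasing|rewrite Hexp; lra]. }
  rewrite exp_plus. apply Rmult_le_compat_l; [left; apply exp_pos|].
  assert (Ha6 : a^3 <= a^6) by (apply Rle_pow; [lra|lia]).
  assert (Hh3 : 0 < h^3) by nra.
  assert (ln 2 * a^3 * h^3 <= 7/10 * (a^6 * h^3)) by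
    (replace (ln 2 * a^3 * h^3) with (ln 2 * (a^3 * h^3)) by ring;
     apply Rmult_le_compat; nra).
  unfold approx. unfold r in Hp |- *. lra.
Qed.

(** Mirror of [term_le], split at [a h = 1/2] since the lower bound for [ln] holds only up to there.
    In that range [a^4 h^3 <= a^3 h^2 / 2], so the extra [- a^4/2] in [r] stays within the
    hypotheses of [exp_perturb]. *)
Lemma term_ge (a h : R) :
  1 <= a -> 0 < h <= / 10^9 -> a * h < 1 ->
  exp (- (ln 2 * a)) * (approx h a - (46/5 * a^6 - ln 2 * 90000 * a) * h^3)
  <= exp (exponent (-90000) h * ln (1 - a * h)).
Proof.
  intros Ha Hh Hy. pose proof ln2_bounds as HL. pose proof coef1_bounds as Hc.
  pose proof (exponent_pos (-90000) h ltac:(lra) Hh) as Hk.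
  set (r := (coef1 * a + 3/4 * a^2 - a^3/3) * h^2 + (90000 * a - a^4/2) * h^3).
  assert (Hh' : 0 < h <= 1/1000000000) by lra.
  assert (Hay : 0 < a * h) by nra.
  assert (Ha23 : 1 <= a /\ a <= a^2 /\ a^2 <= a^3) by (repeat split; nra).
  assert (Hh2 : 0 < h^2) by nra.
  assert (Hah : 0 < a * h^3 <= 1/1000000000 * (a * h^2)).
  { assert (0 < a * h^2) by nra. split; nra. }
  assert (Hh3 : 0 < h^3) by nra.
  destruct (Rle_dec (a * h) (1/2)) as [Hhalf|Hbig].
  - assert (Hexp : - (ln 2 * a) + ln 2 * ((3 * a - a^2) / 2 * h + r)
       <= exponent (-90000) h * ln (1 - a * h)).
    { apply Rle_trans with
        (exponent (-90000) h * (- (a * h + (a * h)^2/2 + (a * h)^3/3 + (a * h)^4/2))).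
      2:{ apply Rmult_le_compat_l; [lra|]. apply ln_1_minus_ge; lra. }
      apply Rminus_le_0. unfold exponent, r.
      replace (_ - _) with (ln 2 * (a * h) * (
           3/2 * ((a*h)^2/3 + (a*h)^3/2)
           + (coef1 + 90000 * h) * h * (a*h/2 + (a*h)^2/3 + (a*h)^3/2)))
        by (field; lra).
      apply Rmult_le_pos; [nra|].
      assert (0 <= (a*h)^2) by nra. assert (0 <= (a*h)^3) by (apply pow_le; lra).
      assert (0 <= (coef1 + 90000 * h) * h * (a*h/2 + (a*h)^2/3 + (a*h)^3/2)).
      { apply Rmult_le_pos; nra. }
      lra. }
    assert (H4h : 0 <= a^4 * h^3 <= 1/2 * (a^3 * h^2)).
    { replace (a^4 * h^3) with ((a * h) * (a^3 * h^2)) by ring.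
      assert (0 <= a^3 * h^2) by nra. split; nra. }
    assert (Hr : Rabs r <= 17/10 * a^3 * h^2).
    { unfold r. apply Rabs_le; split; nra. }
    assert (Hr4 : r <= 4 * h^2).
    { assert (coef1 * a + 3/4 * a^2 - a^3/3 + 90000 * a * h <= 4).
      { assert (coef1 * a <= 1/100 * a) by nra.
        pose proof (cubic_le_4 a Ha). assert (a * h <= 1/1000000000 * a) by nra. lra. }
      apply Rle_trans with
        ((coef1 * a + 3/4 * a^2 - a^3/3 + 90000 * a * h) * h^2).
      - unfold r. lra.
      - apply Rmult_le_compat_r; lra. }
    pose proof (exp_perturb a h r Ha ltac:(lra) ltac:(lra) Hr Hr4) as Hp.
    apply Rabs_le_between in Hp.
    apply Rle_trans with (exp (- (ln 2 * a) + ln 2 * ((3 * a - a^2) / 2 * h + r))).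
    2:{ destruct Hexp as [Hexp|Hexp]; [left; now apply exp_increasing|rewrite Hexp; lra]. }
    rewrite exp_plus. apply Rmult_le_compat_l; [left; apply exp_pos|].
    assert (Ha6 : a^4 <= a^6) by (apply Rle_pow; [lra|lia]).
    assert (ln 2 * a^4 * h^3 <= 7/10 * (a^6 * h^3)) by
      (replace (ln 2 * a^4 * h^3) with (ln 2 * (a^4 * h^3)) by ring;
       apply Rmult_le_compat; nra).
    unfold approx. unfold r in Hp |- *. lra.
  - (* For [a h > 1/2] the cubic error term outweighs the expansion, so the left side is negative. *)
    apply Rle_trans with 0; [|left; apply exp_pos].
    enough (approx h a - (46/5 * a^6 - ln 2 * 90000 * a) * h^3 <= 0)
      by (pose proof (exp_pos (- (ln 2 * a))); nra).
    assert (Hbig' : 1 <= a^2 * h /\ 1000 <= a).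
    { split; [|nra]. assert (1000 <= a) by nra. nra. }
    (* In terms of [q >= 1], the expansion is at most [1 + 2 q + q^2/2] and the [90000] term adds at
       most 1, against [46/5 q^3]. *)
    set (q := a^2 * h) in *.
    set (w := (3 * a - a^2) / 2 * h).
    assert (Hq : 1 <= q) by lra.
    assert (HU : Rabs w <= q).
    { unfold w. rewrite Rabs_mult, (Rabs_right h) by lra.
      apply Rmult_le_compat_r; [lra|]. apply Rabs_le; nra. }
    assert (HLw : Rabs (ln 2 * w) <= q).
    { rewrite Rabs_mult, (Rabs_right (ln 2)) by lra. pose proof (Rabs_pos w). nra. }
    assert (Hu2 : (coef1 * a + 3/4 * a^2 - a^3/3) * h^2 <= q).
    { assert (coef1 * a <= 1/100 * a) by nra.
      apply Rle_trans with (a^2 * h^2); [apply Rmult_le_compat_r; lra|].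
      unfold q. assert (h^2 <= h) by nra. apply Rmult_le_compat_l; lra. }
    assert (H90 : 90000 * a * h^3 <= 1).
    { replace (90000 * a * h^3) with (90000 * (a * h) * h^2) by ring.
      assert (h^2 <= 1/1000000000) by nra. nra. }
    assert (Hq2 : (ln 2 * w)^2 <= q^2) by now apply pow_maj_Rabs.
    apply Rabs_le_between in HLw.
    unfold approx.
    replace (ln 2 * ((3 * a - a^2) / 2) * h) with (ln 2 * w) by (unfold w; ring).
    fold w.
    replace ((46/5 * a^6 - ln 2 * 90000 * a) * h^3) with
      (46/5 * q^3 - ln 2 * (90000 * a * h^3)) by (unfold q; ring).
    assert (ln 2 * (90000 * a * h^3) <= 1).
    { assert (0 <= 90000 * a * h^3) by lra. nra. }
    assert (ln 2 * ((coef1 * a + 3/4 * a^2 - a^3/3) * h^2) <= q).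
    { apply Rle_trans with (ln 2 * q); [apply Rmult_le_compat_l; lra|].
      clear - Hq HL; nra. }
    assert (q <= q^2) by (clear - Hq; nra).
    assert (q^2 <= q^3) by (clear - Hq; nra).
    lra.
Qed.

(** * Summing the expansions over all terms *)

Lemma exp_opp_ln2_INR (n : nat) : exp (- (ln 2 * INR n)) = (1/2)^n.
Proof.
  induction n as [|n IH].
  - simpl; rewrite Rmult_0_r, Ropp_0; apply exp_0.
  - rewrite S_INR. replace (- (ln 2 * (INR n + 1))) with (- ln 2 + - (ln 2 * INR n)) by ring.
    rewrite exp_plus, IH, exp_Ropp, exp_ln by lra. simpl; field.
Qed.

Lemma Rabs_mult_le (a b A B : R) : Rabs a <= A -> 0 <= b <= B -> Rabs (a * b) <= A * B.
Proof.
  intros Ha Hb. rewrite Rabs_mult, (Rabs_right b) by lra.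
  apply Rmult_le_compat; try lra; apply Rabs_pos.
Qed.

(** The full series contributes exactly the subtracted value, with 9366 and 2 the sums of
    [i^6 / 2^i] and [i / 2^i]. Only the tail beyond [n] is left; it decays like [2^(-n)] times a
    polynomial. The sign [s] lets one statement serve both the upper and the lower bound. *)
Lemma sum_half_approx (s : R) (n : nat) :
  let h := / INR (S n) in
  Rabs s <= 1 -> h <= / 10^9 ->
  Rabs (sum_n_m (fun i => (1/2)^i * (approx h (INR i)
           + s * (46/5 * INR i^6 - ln 2 * 90000 * INR i) * h^3)) 1 n
        - (1 + s * (46/5 * 9366 - ln 2 * 180000) * h^3)) <= h^3.
Proof.
  intros h Hs Hh.
  pose proof ln2_bounds as HL. pose proof coef1_bounds as Hc.
  set (N := INR n). assert (HM : INR (S n) = N + 1) by apply S_INR.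
  assert (Hh0 : 0 < h) by (apply Rinv_0_lt_compat, lt_0_INR; lia).
  assert (HhM : h * (N + 1) = 1).
  { unfold h; rewrite HM; apply Rinv_l. rewrite <- HM; apply not_0_INR; lia. }
  assert (HN : 10^9 - 1 <= N).
  { enough (10^9 <= N + 1) by lra.
    apply Rmult_le_reg_l with h; [easy|]. rewrite HhM. lra. }
  set (L := ln 2) in *.
  set (a1 := L * (3/2 * h + coef1 * h^2) - s * 90000 * L * h^3).
  set (a2 := L * (- h/2 + 3/4 * h^2) + L^2 * 9/8 * h^2).
  set (a3 := - (L/3 + 6/8 * L^2) * h^2).
  set (a4 := L^2 / 8 * h^2).
  set (a6 := s * 46/5 * h^3).
  rewrite (sum_n_m_ext _ (fun i => (1/2)^i * (1 + a1 * INR i + a2 * INR i^2 + a3 * INR i^3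
                        + a4 * INR i^4 + a6 * INR i^6 + 0 * INR i^7)))
    by (intros i; apply (f_equal (Rmult _)); unfold approx, a1, a2, a3, a4, a6, L; field).
  rewrite sum_half_poly. fold N.
  match goal with |- Rabs (_ - _ * ?t - _) <= _ => set (T := t) end.
  (* The value of [coef1] enters here: it cancels the [h^2] coefficient of the full series. *)
  replace (_ - _) with (- ((1/2)^n * T))
    by (unfold a1, a2, a3, a4, a6, coef1, L; field).
  rewrite Rabs_Ropp, Rabs_mult, (Rabs_right ((1/2)^n)) by (apply Rle_ge, pow_le; lra).
  assert (Hpow : forall j, 0 < N^j /\ 1000 * N^j <= N^(S j)).
  { intros j. assert (0 < N^j) by (apply pow_lt; lra). simpl; split; nra. }
  pose proof (Hpow 0%nat) as H0. pose proof (Hpow 1%nat) as H1.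
  pose proof (Hpow 2%nat) as H2. pose proof (Hpow 3%nat) as H3.
  pose proof (Hpow 4%nat) as H4. pose proof (Hpow 5%nat) as H5.
  assert (Hh2 : 0 < h^2 <= 1/1000000000 * h) by nra.
  assert (Hh3 : 0 < h^3 <= 1/1000000000 * h^2) by nra.
  assert (HL2 : 0 < L^2 <= 1/2) by nra.
  assert (HL2h : 0 < L^2 * h^2 <= h^2) by nra.
  assert (Hsh : Rabs (s * h^3) <= h^3)
    by (rewrite Rabs_mult, (Rabs_right (h^3)) by lra; nra).
  (* For such large [N] each bracket is at most twice the leading power of [N + 1]; then
     [h (N + 1) = 1] trades powers of [h] for powers of [N + 1]. *)
  assert (Ha1 : Rabs (a1 * (N + 2)) <= 3 * h * (2 * (N + 1))).
  { apply Rabs_mult_le; [|lra]. apply Rabs_le_between in Hsh. unfold a1.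
    assert (- h^3 <= L * (s * h^3) <= h^3) by (split; nra).
    assert (coef1 * h^2 <= h^2) by nra. assert (0 <= coef1 * h^2) by nra.
    assert (0 <= L * (3/2 * h + coef1 * h^2) <= 3/2 * h + coef1 * h^2) by (split; nra).
    apply Rabs_le; lra. }
  assert (Ha2 : Rabs (a2 * (N^2 + 4 * N + 6)) <= h * (2 * (N + 1)^2)).
  { apply Rabs_mult_le; [|lra]. unfold a2. apply Rabs_le.
    assert (- h <= L * (- h/2 + 3/4 * h^2) <= 0) by (split; nra). lra. }
  assert (Ha3 : Rabs (a3 * (N^3 + 6 * N^2 + 18 * N + 26)) <= h^2 * (2 * (N + 1)^3)).
  { apply Rabs_mult_le; [|lra]. unfold a3. apply Rabs_le. split; nra. }
  assert (Ha4 : Rabs (a4 * (N^4 + 8 * N^3 + 36 * N^2 + 104 * N + 150))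
                <= h^2 * (2 * (N + 1)^4)).
  { apply Rabs_mult_le; [|lra]. unfold a4. apply Rabs_le. lra. }
  assert (Ha6 : Rabs (a6 * (N^6 + 12 * N^5 + 90 * N^4 + 520 * N^3 + 2250 * N^2
                + 6492 * N + 9366)) <= 10 * h^3 * (2 * (N + 1)^6)).
  { apply Rabs_mult_le; [|lra]. apply Rabs_le_between in Hsh. unfold a6. apply Rabs_le. lra. }
  assert (HT : Rabs T <= 30 * (N + 1)^3).
  { replace (3 * h * (2 * (N + 1))) with (6 * (h * (N+1))) in Ha1 by ring.
    replace (h * (2 * (N + 1)^2)) with (2 * (h * (N+1)) * (N+1)) in Ha2 by ring.
    replace (h^2 * (2 * (N + 1)^3)) with (2 * (h * (N+1))^2 * (N+1)) in Ha3 by ring.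
    replace (h^2 * (2 * (N + 1)^4)) with (2 * (h * (N+1))^2 * (N+1)^2) in Ha4 by ring.
    replace (10 * h^3 * (2 * (N + 1)^6)) with (20 * (h * (N+1))^3 * (N+1)^3) in Ha6 by ring.
    rewrite HhM in Ha1, Ha2, Ha3, Ha4, Ha6.
    apply Rabs_le_between in Ha1, Ha2, Ha3, Ha4, Ha6.
    unfold T. apply Rabs_le. lra. }
  pose proof (pow7_half_le n) as H7. fold N in H7.
  assert (Hp : 0 < (1/2)^n) by (apply pow_lt; lra).
  assert (HM7 : (1/2)^n * (N+1)^7 <= 128 * 94586).
  { apply Rle_trans with ((1/2)^n * (2 * N)^7).
    - apply Rmult_le_compat_l; [lra|]. apply pow_incr; lra.
    - rewrite Rpow_mult_distr. lra. }
  apply Rle_trans with ((1/2)^n * (30 * (N + 1)^3)).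
  { apply Rmult_le_compat_l; lra. }
  (* Four further powers of [N + 1] buy the factor [h^4], whose spare [h <= 10^(-9)] beats the
     constant [30 * 128 * 94586], about [3.7 * 10^8]. *)
  replace ((1/2)^n * (30 * (N+1)^3)) with
    (30 * h^4 * ((1/2)^n * (N+1)^7 )).
  2:{ replace (30 * h^4 * ((1/2)^n * (N+1)^7)) with
        (30 * (1/2)^n * (N+1)^3 * (h * (N+1))^4) by ring. rewrite HhM; ring. }
  assert (Hh4 : 0 < h^4 <= 1/1000000000 * h^3) by (replace (h^4) with (h * h^3) by ring; nra).
  apply Rle_trans with (30 * h^4 * (128 * 94586)); [|lra].
  apply Rmult_le_compat_l; lra.
Qed.

Lemma INR_mult_inv_bounds (n i : nat) :
  (1 <= i <= n)%nat -> 1 <= INR i /\ INR i * / INR (S n) < 1.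
Proof.
  intros Hi. split; [apply (le_INR 1); lia|].
  apply Rlt_div_l; [apply lt_0_INR; lia|]. rewrite Rmult_1_l; apply lt_INR; lia.
Qed.

(** The [h^3] coefficient is [46/5 * 9366 - 180000 ln 2], about -38600, well below the error of 1
    allowed by [sum_half_approx]. A parameter above about 62200 suffices for this sign. *)
Lemma sum_upper_exponent_lt_1 (n : nat) :
  let h := / INR (S n) in
  h <= / 10^9 ->
  sum_n_m (fun i => exp (exponent 90000 h * ln (1 - INR i * h))) 1 n < 1.
Proof.
  intros h Hh.
  assert (Hh0 : 0 < h) by (apply Rinv_0_lt_compat, lt_0_INR; lia).
  assert (Hh3 : 0 < h^3) by now apply pow_lt.
  pose proof ln2_bounds as HL.
  pose proof (sum_half_approx 1 n ltac:(rewrite Rabs_R1; lra) Hh) as H; fold h in H.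
  apply Rabs_le_between in H.
  eapply Rle_lt_trans; [apply sum_n_m_1_le with (g := fun i => (1/2)^i * (approx h (INR i)
           + 1 * (46/5 * INR i^6 - ln 2 * 90000 * INR i) * h^3))|nra].
  intros i Hi. destruct (INR_mult_inv_bounds n i Hi) as [Hi1 Hi2].
  rewrite <- exp_opp_ln2_INR, Rmult_1_l. now apply term_le.
Qed.

Lemma sum_lower_exponent_gt_1 (n : nat) :
  let h := / INR (S n) in
  h <= / 10^9 ->
  1 < sum_n_m (fun i => exp (exponent (-90000) h * ln (1 - INR i * h))) 1 n.
Proof.
  intros h Hh.
  assert (Hh0 : 0 < h) by (apply Rinv_0_lt_compat, lt_0_INR; lia).
  assert (Hh3 : 0 < h^3) by now apply pow_lt.
  pose proof ln2_bounds as HL.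
  pose proof (sum_half_approx (-1) n
    ltac:(rewrite Rabs_left; lra) Hh) as H; fold h in H.
  apply Rabs_le_between in H.
  eapply Rlt_le_trans; [|apply sum_n_m_1_le with (f := fun i => (1/2)^i * (approx h (INR i)
           + -1 * (46/5 * INR i^6 - ln 2 * 90000 * INR i) * h^3))]; [nra|].
  intros i Hi. destruct (INR_mult_inv_bounds n i Hi) as [Hi1 Hi2].
  rewrite <- exp_opp_ln2_INR.
  replace (_ + -1 * _ * _) with
    (approx h (INR i) - (46/5 * INR i^6 - ln 2 * 90000 * INR i) * h^3) by ring.
  now apply term_ge.
Qed.

(** * Locating the root and reading off both estimates *)

Lemma erdos_moser_sum (n : nat) (k : R) :
  erdos_moser (S n) k ->
  sum_n_m (fun i => exp (k * ln (1 - INR i * / INR (S n)))) 1 n = 1.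
Proof.
  unfold erdos_moser. replace (S n - 1)%nat with n by lia. rewrite sum_n_m_1_rev.
  intros H.
  assert (HM : 0 < INR (S n)) by (apply lt_0_INR; lia).
  assert (Hpos : 0 < Rpower (INR (S n)) k) by apply exp_pos.
  apply Rmult_eq_reg_l with (Rpower (INR (S n)) k); [|lra].
  rewrite Rmult_1_r; refine (eq_trans _ H).
  etransitivity; [symmetry; apply (sum_n_m_mult_l (K := R_Ring))|].
  apply sum_n_m_ext_loc.
  intros i Hi. destruct (INR_mult_inv_bounds n i Hi) as [Hi1 Hi2].
  change (Rpower (INR (S n)) k * Rpower (1 - INR i * / INR (S n)) k
    = Rpower (INR (S n - i)) k).
  rewrite Rpower_mult_distr by lra. f_equal.
  rewrite minus_INR by lia. field; lra.
Qed.

Lemma sum_exponent_antitone (n : nat) (k k' : R) :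
  k <= k' ->
  sum_n_m (fun i => exp (k' * ln (1 - INR i * / INR (S n)))) 1 n
  <= sum_n_m (fun i => exp (k * ln (1 - INR i * / INR (S n)))) 1 n.
Proof.
  intros Hk. apply sum_n_m_1_le. intros i Hi.
  destruct (INR_mult_inv_bounds n i Hi) as [Hi1 Hi2].
  assert (0 < INR i * / INR (S n)).
  { apply Rmult_lt_0_compat; [lra|]. apply Rinv_0_lt_compat, lt_0_INR; lia. }
  assert (Hln : ln (1 - INR i * / INR (S n)) < 0) by (rewrite <- ln_1; apply ln_increasing; lra).
  assert (Hle : k' * ln (1 - INR i * / INR (S n)) <= k * ln (1 - INR i * / INR (S n)))
    by nra.
  destruct Hle as [Hlt| ->]; [left; now apply exp_increasing|apply Rle_refl].
Qed.

(** The sum equals 1 at [k] but lies on opposite sides of 1 at the exponents with parameters 90000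
    and -90000, so monotonicity traps [k] strictly between them. *)
Lemma erdos_moser_exponent (m : nat) (k : R) :
  10^9 < INR m -> erdos_moser m k ->
  exists e, Rabs e <= 90000 /\ k = exponent e (/ INR m).
Proof.
  intros Hm Hk. destruct m as [|n]; [simpl in Hm; lra|].
  set (h := / INR (S n)).
  assert (Hh0 : 0 < h) by (apply Rinv_0_lt_compat; lra).
  assert (Hh : h <= / 10^9) by (apply Rinv_le_contravar; lra).
  pose proof (erdos_moser_sum n k Hk) as Hsum.
  pose proof (sum_upper_exponent_lt_1 n Hh) as Hup.
  pose proof (sum_lower_exponent_gt_1 n Hh) as Hlow. fold h in Hsum, Hup, Hlow.
  pose proof ln2_bounds as HL.
  assert (Hk1 : k < exponent 90000 h).
  { apply Rnot_le_lt; intros Hle.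
    pose proof (sum_exponent_antitone n _ _ Hle) as H; fold h in H; lra. }
  assert (Hk2 : exponent (-90000) h < k).
  { apply Rnot_le_lt; intros Hle.
    pose proof (sum_exponent_antitone n _ _ Hle) as H; fold h in H; lra. }
  assert (Hlh : 0 < ln 2 * h^2) by (apply Rmult_lt_0_compat; [lra|now apply pow_lt]).
  (* The exponent is affine in [e] with positive slope, so [e] is found by solving a linear
     equation. *)
  assert (Hexp : forall e, exponent e h = exponent 0 h + e * (ln 2 * h^2))
    by (intros e; unfold exponent; field; lra).
  rewrite Hexp in Hk1, Hk2.
  exists ((k - exponent 0 h) / (ln 2 * h^2)). split.
  - apply Rabs_le; split; [apply Rle_div_r|apply Rle_div_l]; lra.
  - rewrite Hexp. field. lra.
Qed.

Theorem theorem1 :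
  389 / 100000 <= coef1 < 390 / 100000 /\
  (exists (K : R) (M : nat), forall (m : nat) (k : R),
     (0 < m)%nat -> 0 < k -> erdos_moser m k -> (M <= m)%nat ->
     exists E : R,
       Rabs E <= K * (1 / INR m ^ 2) /\
       k = ln 2 * (INR m - 3 / 2 - coef1 / INR m + E)) /\
  (forall (m : nat) (k : R),
     (0 < m)%nat -> 0 < k -> erdos_moser m k -> 10 ^ 9 < INR m ->
     exists C : R,
       0 < C < 4 / 1000 /\
       k / INR m = ln 2 * (1 - 3 / (2 * INR m) - C / INR m ^ 2)).
Proof.
  split; [exact coef1_bounds|split].
  - destruct (INR_unbounded (10^9)) as [M HM].
    exists 90000, M. intros m k _ _ Hk Hm.
    assert (Hm9 : 10^9 < INR m) by (apply le_INR in Hm; lra).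
    destruct (erdos_moser_exponent m k Hm9 Hk) as [e [He ->]].
    assert (0 < INR m ^ 2) by (apply pow_lt; lra).
    exists (e * (1 / INR m ^ 2)). split.
    + rewrite Rabs_mult, (Rabs_right (1 / INR m ^ 2)).
      * apply Rmult_le_compat_r; [|easy]. apply Rdiv_le_0_compat; lra.
      * apply Rle_ge, Rdiv_le_0_compat; lra.
    + unfold exponent. field. lra.
  - intros m k _ _ Hk Hm.
    destruct (erdos_moser_exponent m k Hm Hk) as [e [He ->]].
    (* Here [|e / m| <= 0.00009], which fits both margins: [coef1 >= 0.00389] keeps the value
       positive, and [coef1 < 0.0039] keeps it below 0.004. *)
    exists (coef1 - e / INR m). split.
    + assert (Hem : Rabs (e / INR m) <= 90000 / 10^9).
      { unfold Rdiv. rewrite Rabs_mult, (Rabs_right (/ INR m)).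
        - apply Rmult_le_compat; [apply Rabs_pos| |easy|].
          + left; apply Rinv_0_lt_compat; lra.
          + apply Rinv_le_contravar; lra.
        - apply Rle_ge; left; apply Rinv_0_lt_compat; lra. }
      apply Rabs_le_between in Hem. pose proof coef1_bounds. lra.
    + unfold exponent. field. lra.
Qed.
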